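(* Let $\mathbb{T}$ be a time scale, let $a,b\in\mathbb{T}$ with $a<b$, let $[a,b]$ denote the interval $\{t\in\mathbb{T}: a\le t\le b\}$ in $\mathbb{T}$, and let $0\le\alpha\le 1$. Let $f,g:[a,b]\rightarrow\mathbb{R}$ be continuous functions, let $p>1$ and $q=\frac{p}{p-1}$. Then $$\int_a^b |f(t)g(t)|\,\Diamond_\alpha t \leq \left[\int_a^b |f(t)|^p\,\Diamond_\alpha t\right]^{\frac{1}{p}}\left[\int_a^b |g(t)|^q\,\Diamond_\alpha t\right]^{\frac{1}{q}}.$$
   Context: A time scale $\mathbb{T}$ is a nonempty closed subset of $\mathbb{R}$, with the topology induced from $\mathbb{R}$. The forward and backward jump operators $\sigma,\rho:\mathbb{T}\to\mathbb{T}$ are $\sigma(t)=\inf\{s\in\mathbb{T}: s>t\}$ and $\rho(t)=\sup\{s\in\mathbb{T}: s<t\}$, with the conventions $\inf\emptyset=\sup\mathbb{T}$ and $\sup\emptyset=\inf\mathbb{T}$. For $a<b$ in $\mathbb{T}$, $[a,b]$ denotes $\{t\in\mathbb{T}: a\le t\le b\}$. A function $F:[a,b]\to\mathbb{R}$ has delta derivative $F^\Delta(t)$ at $t\in[a,b]$, $t<b$, if for every $\varepsilon>0$ there is a neighborhood $U$ of $t$ in $[a,b]$ with $|F(\sigma(t))-F(s)-F^\Delta(t)(\sigma(t)-s)|\le\varepsilon|\sigma(t)-s|$ for all $s\in U$. It has nabla derivative $F^\nabla(t)$ at $t\in[a,b]$, $t>a$, if for every $\varepsilon>0$ there is a neighborhood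 $U$ of $t$ in $[a,b]$ with $|F(\rho(t))-F(s)-F^\nabla(t)(\rho(t)-s)|\le\varepsilon|\rho(t)-s|$ for all $s\in U$. For continuous $f:[a,b]\to\mathbb{R}$, the delta integral is $\int_a^b f(t)\,\Delta t=F(b)-F(a)$, where $F$ is a delta antiderivative of $f$ (a continuous $F:[a,b]\to\mathbb{R}$ with $F^\Delta(t)=f(t)$ for all $t\in[a,b]$, $t<b$); the nabla integral is $\int_a^b f(t)\,\nabla t=G(b)-G(a)$, where $G$ is a nabla antiderivative of $f$ (a continuous $G:[a,b]\to\mathbb{R}$ with $G^\nabla(t)=f(t)$ for all $t\in[a,b]$, $t>a$). Both integrals exist and are well defined for continuous $f$. For $0\le\alpha\le1$, the diamond-$\alpha$ integral is $$\int_a^b f(t)\,\Diamond_\alpha t=\alpha\int_a^b f(t)\,\Delta t+(1-\alpha)\int_a^b f(t)\,\nabla t.$$ *)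

(* Defs.v *)
From HB Require Import structures.
From mathcomp Require Import all_boot all_order all_algebra.
From mathcomp Require Import all_classical all_reals all_analysis.

Set Implicit Arguments.
Unset Strict Implicit.
Unset Printing Implicit Defensive.

Import Order.TTheory GRing.Theory Num.Theory.
Import numFieldNormedType.Exports.

Local Open Scope classical_set_scope.
Local Open Scope ring_scope.

Definition time_scale (R : realType) (T : set R) : Prop :=
  T !=set0 /\ closed T.

Definition ts_itv (R : realType) (T : set R) (a b : R) : set R :=
  [set t | T t /\ a <= t <= b].

(* The set whose infimum is taken is bounded below by t, and the default sup T
   is only reached for t in T when t is the maximum of T, so that the
   library's sup and inf on R are never applied to an unbounded or empty set
   (dually for the backward jump). *)
Definition forward_jump (R : realType) (T : set R) (t : R) : R :=
  let A := [set s | T s /\ t < s] in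
  if `[< A = set0 >] then sup T else inf A.

Definition backward_jump (R : realType) (T : set R) (t : R) : R :=
  let A := [set s | T s /\ s < t] in
  if `[< A = set0 >] then inf T else sup A.

(* A function on [a, b] is represented by a function on R, of which only the
   values on ts_itv T a b matter: neighborhoods and continuity are always taken
   within ts_itv T a b. *)
Definition is_delta_derivative (R : realType) (T : set R) (a b : R)
    (F : R -> R) (t l : R) : Prop :=
  let st := forward_jump T t in
  forall eps : R, 0 < eps ->
    \forall s \near within (ts_itv T a b) (nbhs t),
      `|F st - F s - l * (st - s)| <= eps * `|st - s|.

Definition is_nabla_derivative (R : realType) (T : set R) (a b : R)
    (F : R -> R) (t l : R) : Prop :=
  let rt := backward_jump T t in
  forall eps : R, 0 < eps ->
    \forall s \near within (ts_itv T a b) (nbhs t),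
      `|F rt - F s - l * (rt - s)| <= eps * `|rt - s|.

Definition delta_antiderivative (R : realType) (T : set R) (a b : R)
    (f F : R -> R) : Prop :=
  {within ts_itv T a b, continuous F} /\
  forall t, ts_itv T a b t -> t < b -> is_delta_derivative T a b F t (f t).

Definition nabla_antiderivative (R : realType) (T : set R) (a b : R)
    (f G : R -> R) : Prop :=
  {within ts_itv T a b, continuous G} /\
  forall t, ts_itv T a b t -> a < t -> is_nabla_derivative T a b G t (f t).

(* For f continuous on ts_itv T a b the set of candidate values is a singleton;
   the default 0 is a junk value for functions without an antiderivative. *)
Definition delta_integral (R : realType) (T : set R) (a b : R)
    (f : R -> R) : R :=
  xget 0 [set F b - F a | F in [set F | delta_antiderivative T a b f F]].

Definition nabla_integral (R : realType) (T : set R) (a b : R)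
    (f : R -> R) : R :=
  xget 0 [set G b - G a | G in [set G | nabla_antiderivative T a b f G]].

Definition diamond_integral (R : realType) (T : set R) (alpha a b : R)
    (f : R -> R) : R :=
  alpha * delta_integral T a b f + (1 - alpha) * nabla_integral T a b f.

(* Main.v *)
(** A delta antiderivative of a continuous f is the Lebesgue integral
    t |-> \int_[a, t] f (tau x) dx, where tau x is the last point of [a, b] in T
    not exceeding x. A nonnegative delta derivative forces F a <= F b, which
    makes the delta integral well defined and monotone; the nabla integral is
    the delta integral of the reflected time scale -T. The diamond integral is
    thus a positive linear functional I on continuous functions. Integrating
    Young's inequality for c |f| and d |g| with c = (I |f|^p + e)^(-1/p) and
    d = (I |g|^q + e)^(-1/q) gives Hoelder's inequality up to e, and e tends
    to 0: the shift by e spares the case of a vanishing integral. *)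

Require Import Defs.
From HB Require Import structures.
From mathcomp Require Import all_boot all_order all_algebra.
From mathcomp Require Import all_classical all_reals all_analysis.
From mathcomp Require Import measurable_realfun ring lra.

Set Implicit Arguments.
Unset Strict Implicit.
Unset Printing Implicit Defensive.

Import Order.TTheory GRing.Theory Num.Theory.
Import numFieldNormedType.Exports.

Local Open Scope classical_set_scope.
Local Open Scope ring_scope.

(** * Epsilon-delta forms of limits within a set, and closed sets of reals *)

Lemma near_within_normP (R : realType) (A : set R) (t : R) (P : R -> Prop) :
  (\forall s \near within A (nbhs t), P s) <->
  exists2 d : R, 0 < d & forall s, A s -> `|s - t| < d -> P s.
Proof.
split.
- move=> /nbhs_ballP[d /= d0 H]; exists d => // s As st.
  by apply: H => //; rewrite /ball/= distrC.
- move=> [d d0 H]; apply/nbhs_ballP; exists d => //= s.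
  by rewrite /ball/= distrC => st As; exact: H.
Qed.

Lemma within_continuous_normP (R : realType) (A : set R) (f : R -> R) :
  {within A, continuous f} <->
  forall t, A t -> forall e : R, 0 < e ->
    exists2 d : R, 0 < d & forall s, A s -> `|s - t| < d -> `|f s - f t| < e.
Proof.
rewrite subspace_continuousP; split.
- move=> H t At e e0; apply/near_within_normP.
  have /cvgrPdist_lt/(_ e e0) := H _ At.
  by apply: filterS => s; rewrite distrC.
- move=> H t At; apply/cvgrPdist_lt => e e0.
  have /near_within_normP := H _ At _ e0.
  by apply: filterS => s; rewrite distrC.
Qed.

Lemma closed_normP (R : realType) (A : set R) (x : R) : closed A ->
  (forall d : R, 0 < d -> exists2 s, A s & `|s - x| < d) -> A x.
Proof.
move=> cA H; apply: cA => B /nbhs_ballP[d /= d0 dB].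
have [s As sx] := H _ d0; exists s; split => //; apply: dB.
by rewrite /ball/= distrC.
Qed.

Lemma closed_sup_mem (R : realType) (A E : set R) : closed A -> E `<=` A ->
  has_sup E -> A (sup E).
Proof.
move=> cA EA sE; apply: closed_normP => // d d0.
have [s Es ds] := sup_adherent d0 sE; exists s; first exact: EA.
have := ub_le_sup (proj2 sE) Es => sle.
by rewrite ler0_norm ?subr_le0// opprB ltrBlDr -ltrBlDl.
Qed.

Lemma closed_ts_itv (R : realType) (T : set R) (a b : R) :
  closed T -> closed (ts_itv T a b).
Proof.
move=> cT; rewrite (_ : ts_itv T a b = T `&` `[a, b]%classic); last first.
  by apply/seteqP; split=> x /=; rewrite in_itv.
by apply: closedI => //; exact: interval_closed.
Qed.

Lemma compact_ts_itv (R : realType) (T : set R) (a b : R) :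
  closed T -> compact (ts_itv T a b).
Proof.
move=> cT; apply: (@subclosed_compact _ _ `[a, b]%classic).
- exact: closed_ts_itv.
- exact: segment_compact.
- by move=> x []; rewrite /= in_itv.
Qed.

(** * The forward jump at a point with a later point of the time scale *)

Section forward_jump_theory.
Variables (R : realType) (T : set R) (t b : R).
Hypotheses (cT : closed T) (Tb : T b) (tb : t < b).

Let A := [set s | T s /\ t < s].

Let has_infA : has_inf A.
Proof. by split; [exists b | exists t => s [_ /ltW]]. Qed.

(** As [b] lies in [A], the default branch [sup T] is excluded. *)
Let forward_jumpE : forward_jump T t = inf A.
Proof.
rewrite /forward_jump; case: asboolP => // A0.
by have : A b by []; rewrite /A A0.
Qed.

Lemma forward_jump_ge : t <= forward_jump T t.
Proof.
by rewrite forward_jumpE; apply: lb_le_inf; [case: has_infA|move=> s [_ /ltW]].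
Qed.

Lemma forward_jump_le s : T s -> t < s -> forward_jump T t <= s.
Proof. by move=> Ts ts; rewrite forward_jumpE; apply: ge_inf => //; case: has_infA. Qed.

(** When [t] is right-dense, this supplies points of [T] just to its right. *)
Lemma forward_jump_adherent (d : R) : 0 < d ->
  exists s, [/\ T s, t < s & s < forward_jump T t + d].
Proof.
move=> d0; have [s [Ts ts] sd] := inf_adherent d0 has_infA.
by exists s; rewrite forward_jumpE.
Qed.

Lemma forward_jump_mem : T (forward_jump T t).
Proof.
apply: closed_normP => // d d0.
have [s [Ts ts sd]] := forward_jump_adherent d0; exists s => //.
have := forward_jump_le Ts ts => ?.
by rewrite ger0_norm ?subr_ge0// ltrBlDl.
Qed.

End forward_jump_theory.

(** * Monotonicity, linearity and uniqueness for delta antiderivatives *)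

(** Real induction along [a, b]: the slack [e * (s - a)] absorbs the error allowed by the delta
    derivative, and the supremum [c] of the points up to which the weakened bound [P] holds can only
    be [b]. *)
Lemma delta_antiderivative_ge0_le (R : realType) (T : set R) (a b : R)
    (f F : R -> R) :
  closed T -> T a -> T b -> a < b ->
  delta_antiderivative T a b f F ->
  (forall t, ts_itv T a b t -> 0 <= f t) -> F a <= F b.
Proof.
move=> cT Ta Tb ab [/within_continuous_normP cF dF] f0.
set S := ts_itv T a b in cF dF f0.
suff H (e : R) : 0 < e -> F a - e * (b - a) <= F b.
  apply/ler_addgt0Pr => e e0.
  have ba0 : 0 < b - a by rewrite subr_gt0.
  have := H _ (divr_gt0 e0 ba0).
  by rewrite divfK ?gt_eqF// lerBlDr.
move=> e0.
(* P is preserved at limits from the left by continuity of F, and passes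
   from c to points to its right by the derivative at c. *)
pose P s := F a - e * (s - a) <= F s.
pose E := [set t | S t /\ forall s, S s -> s <= t -> P s].
have Sa : S a by split => //; rewrite lexx ltW.
have Sb : S b by split => //; rewrite lexx ltW.
have Ea : E a.
  split => // s [_ /andP[as_ _]] sa; have -> : s = a by lra.
  by rewrite /P subrr mulr0 subr0.
have sE : has_sup E by split; [exists a | exists b => t [[_ /andP[]]]].
pose c := sup E.
have Sc : S c.
  by apply: closed_sup_mem => //; [exact: closed_ts_itv|move=> ? []].
have ub t : E t -> t <= c by move=> ?; apply: ub_le_sup => //; case: sE.
have Ec : E c.
  have lt_c s : S s -> s < c -> P s.
    move=> Ss sc; have [t [St tP] st] := @sup_gt _ E s (proj1 sE) sc.
    by apply: tP => //; exact: ltW.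
  split=> // s Ss; rewrite le_eqVlt => /predU1P[->|]; last exact: lt_c.
  apply/ler_addgt0Pr => eta eta0.
  have [d d0 dc] := cF _ Sc _ eta0.
  have [t Et dt] := sup_adherent d0 sE.
  have tc := ub _ Et.
  have : `|F t - F c| < eta.
    by case: Et => St _; apply: dc => //; rewrite ler0_norm ?subr_le0 // -/c in dt *; lra.
  rewrite ltr_norml => /andP[_ h].
  have := Et.2 _ Et.1 (lexx _); rewrite /P => h2.
  have : e * (t - a) <= e * (c - a) by rewrite ler_pM2l// lerD2r.
  lra.
suff cb : c = b by have := Ec.2 _ Sb; rewrite cb lexx => /(_ isT).
apply/eqP; rewrite eq_le (andP Sc.2).2 /= leNgt; apply/negP => cb.
have ac := (andP Sc.2).1.
have fc := f0 _ Sc.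
have Pc : P c by apply: Ec.2.
have /near_within_normP[d d0 dH] := dF _ Sc cb _ e0.
have ge := forward_jump_ge Tb cb.
have le := forward_jump_le Tb cb.
have adh := @forward_jump_adherent _ _ _ _ Tb cb.
have mem := forward_jump_mem cT Tb cb.
set st := forward_jump T c in dH ge le adh mem.
move: ge; rewrite le_eqVlt => /predU1P[cst|cst].
(* Right-dense [c]: each [u] of [a, b] in ]c, s] is within [d] of [c], so F u >= F c + (f c - e) (u
   - c), which gives [P u]. Hence [s] belongs to [E] beyond its supremum. *)
- have dbc : 0 < Num.min d (b - c) by rewrite lt_min d0 subr_gt0.
  have [s [Ts cs]] := adh _ dbc.
  rewrite -cst -ltrBlDl lt_min => /andP[sd sb].
  suff /ub : E s by lra.
  split=> [|u Su us]; first by split => //; lra.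
  have [uc|cu] := leP u c; first exact: Ec.2.
  have uc : `|u - c| = u - c by rewrite gtr0_norm// subr_gt0.
  have udc : `|u - c| < d by lra.
  have := dH u Su udc.
  rewrite -cst ler_norml [`|c - u|]distrC uc => /andP[h1 h2].
  have : 0 <= f c * (u - c) by rewrite mulr_ge0// subr_ge0 ltW.
  move: Pc; rewrite /P; lra.
(* Right-scattered [c]: the only point of [T] in ]c, st] is [st], and the derivative estimate taken
   at [c] itself bounds F st - F c from below. *)
- have stb : st <= b by apply: le.
  suff /ub : E st by lra.
  split=> [|u Su us]; first by split => //; lra.
  have [uc|cu] := leP u c; first exact: Ec.2.
  have -> : u = st by apply: le_anti; rewrite us le//; case: Su.
  have := dH c Sc; rewrite subrr normr0.
  rewrite ler_norml [`|st - c|]gtr0_norm ?subr_gt0// => /(_ d0)/andP[h1 h2].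
  have : 0 <= f c * (st - c) by rewrite mulr_ge0// subr_ge0 ltW.
  move: Pc; rewrite /P; lra.
Qed.

Lemma within_continuous_lincomb (R : realType) (A : set R) (k : R)
    (f g : R -> R) :
  {within A, continuous f} -> {within A, continuous g} ->
  {within A, continuous (fun t => k * f t + g t)}.
Proof.
move=> cf cg; apply: (@within_continuousD _ _ _ _ (fun t => k * f t)) => //.
by move=> x; apply: cvgM; [exact: cvg_cst|exact: cf].
Qed.

Lemma delta_antiderivativeZD (R : realType) (T : set R) (a b k : R)
    (f g F G : R -> R) :
  delta_antiderivative T a b f F -> delta_antiderivative T a b g G ->
  delta_antiderivative T a b (fun t => k * f t + g t)
    (fun t => k * F t + G t).
Proof.
move=> [cF dF] [cG dG]; split; first exact: within_continuous_lincomb.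
move=> t St tb st e e0.
(* The tolerance e / 2 / (|k| + 1) for [F] leaves an error of at most e / 2 after multiplication by
   [k]; the [+ 1] covers [k = 0]. *)
have k0 : 0 < `|k| + 1 by rewrite ltr_wpDl.
have e20 : 0 < e / 2 by lra.
have /near_within_normP[d1 d10 H1] := dF t St tb _ (divr_gt0 e20 k0).
have /near_within_normP[d2 d20 H2] := dG t St tb _ e20.
apply/near_within_normP; exists (Num.min d1 d2); first by rewrite lt_min d10.
move=> s Ss; rewrite lt_min => /andP[/(H1 _ Ss) h1 /(H2 _ Ss) h2].
rewrite -/st in h1 h2.
set A := F st - F s - f t * (st - s) in h1.
set B := G st - G s - g t * (st - s) in h2.
rewrite [X in `|X|](_ : _ = k * A + B); last by rewrite /A /B; ring.
have -> : e * `|st - s| = (`|k| + 1) * (e / 2 / (`|k| + 1) * `|st - s|) +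
    e / 2 * `|st - s|.
  by rewrite mulrA [(`|k| + 1) * _]mulrC divfK ?gt_eqF// -mulrDl -splitr.
apply: (le_trans (ler_normD _ _)); apply: lerD => //.
by rewrite normrM; apply: ler_pM => //; rewrite lerDl.
Qed.

(** [G - F] is a delta antiderivative of the nonnegative function [g - f]. *)
Lemma delta_antiderivative_le (R : realType) (T : set R) (a b : R)
    (f g F G : R -> R) :
  closed T -> T a -> T b -> a < b ->
  delta_antiderivative T a b f F -> delta_antiderivative T a b g G ->
  (forall t, ts_itv T a b t -> f t <= g t) -> F b - F a <= G b - G a.
Proof.
move=> cT Ta Tb ab dF dG fg.
have /= := delta_antiderivative_ge0_le cT Ta Tb ab (delta_antiderivativeZD (-1) dF dG).
move=> H; have : -1 * F a + G a <= -1 * F b + G b.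
  by apply: H => t /fg fgt; rewrite mulN1r addrC subr_ge0.
lra.
Qed.

(** Comparing [f] with itself in both directions shows that all antiderivatives have the same
    increment, so [xget] chooses from a singleton. *)
Lemma delta_integralE (R : realType) (T : set R) (a b : R) (f F : R -> R) :
  closed T -> T a -> T b -> a < b ->
  delta_antiderivative T a b f F -> delta_integral T a b f = F b - F a.
Proof.
move=> cT Ta Tb ab dF; apply: xget_unique => [|_ [G dG <-]].
  by exists F.
by apply: le_anti; rewrite !(@delta_antiderivative_le _ T a b f f).
Qed.

(** * Existence of delta antiderivatives by Lebesgue integration *)

(** The quantity is the integral of [h - l] over the open interval ]s, t[, endpoints being null.
    Asking for the bound only strictly inside matters later, when [h] may jump at [t]. *)
Lemma Rintegral_itv_approx (R : realType) (a b s t l e : R) (h : R -> R) :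
  (@lebesgue_measure R).-integrable `[a, b] (EFin \o h) ->
  a <= s -> s <= t -> t <= b ->
  (forall x, s < x -> x < t -> `|h x - l| <= e) ->
  `|\int[@lebesgue_measure R]_(x in `[a, t]) h x -
    \int[@lebesgue_measure R]_(x in `[a, s]) h x - l * (t - s)|
  <= e * (t - s).
Proof.
move=> ih as_ st tb hl.
have iat : (@lebesgue_measure R).-integrable `[a, t] (EFin \o h).
  by apply: integrableS ih => //; apply: subset_itvl; rewrite bnd_simp.
rewrite Rintegral_itvB ?bnd_simp//.
have ist : (@lebesgue_measure R).-integrable `]s, t[ (EFin \o h).
  apply: integrableS iat => // x; rewrite /= !in_itv/= => /andP[? ?].
  by apply/andP; split; lra.
have ist' : (@lebesgue_measure R).-integrable `]s, t] (EFin \o h).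
  apply: integrableS iat => // x; rewrite /= !in_itv/= => /andP[? ?].
  by apply/andP; split; lra.
rewrite -Rintegral_itv_bndo_bndc//.
have icst k : (@lebesgue_measure R).-integrable `]s, t[ (EFin \o cst k).
  apply: measurable_bounded_integrable => //.
    by rewrite /= lebesgue_measure_itv/=; case: ifP => _; rewrite -?EFinB ltry.
  by exists `|k|; split; [exact: num_real|move=> M kM x _; exact: ltW].
have Ecst k : k * (t - s) = \int[@lebesgue_measure R]_(x in `]s, t[) k.
  rewrite Rintegral_cst//= lebesgue_measure_itv/= lte_fin.
  by move: st; rewrite le_eqVlt => /predU1P[->|->//]; rewrite ltxx subrr.
rewrite !Ecst -RintegralB//; last exact: icst.
have isub : (@lebesgue_measure R).-integrable `]s, t[ (EFin \o (fun x => h x - l)).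
  exact: (integrableB _ ist (icst l)).
apply: le_trans (le_normr_Rintegral _ isub) _ => //.
apply: le_Rintegral => //.
- exact: integrable_norm.
- exact: icst.
- by move=> x; rewrite /= in_itv/= => /andP[? ?]; exact: hl.
Qed.

Section delta_antiderivative_exists.
Variables (R : realType) (T : set R) (a b : R) (f : R -> R).
Hypotheses (cT : closed T) (Ta : T a) (Tb : T b) (ab : a < b).
Hypothesis cf : {within ts_itv T a b, continuous f}.

Let S := ts_itv T a b.

(** [Num.max a x] keeps the set nonempty for [x < a], so that the map is total, monotone and with
    values in [S]. *)
Let floor_ts x := sup [set s | S s /\ s <= Num.max a x].

Let Sa : S a. Proof. by split => //; rewrite lexx ltW. Qed.

Let has_sup_floor x : has_sup [set s | S s /\ s <= Num.max a x].
Proof.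
split; first by exists a; split => //; rewrite le_max lexx.
by exists b => s [[_ /andP[]]].
Qed.

Let floor_ts_mem x : S (floor_ts x).
Proof. by apply: closed_sup_mem => //; [exact: closed_ts_itv|move=> ? []]. Qed.

Let floor_ts_le x : a <= x -> floor_ts x <= x.
Proof.
move=> ax; apply: ge_sup; first by case: (has_sup_floor x).
by move=> s [_]; rewrite max_r.
Qed.

Let floor_ts_ge s x : S s -> s <= x -> s <= floor_ts x.
Proof.
move=> Ss sx; apply: ub_le_sup; first by case: (has_sup_floor x).
by split => //; rewrite le_max sx orbT.
Qed.

Let floor_ts_homo : nondecreasing_fun floor_ts.
Proof.
move=> x y xy; apply: ge_sup; first by case: (has_sup_floor x).
move=> s [Ss sx]; apply: ub_le_sup; first by case: (has_sup_floor y).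
by split => //; apply: le_trans sx _; rewrite ge_max !le_max lexx/= xy orbT.
Qed.

Let bounded_f : exists2 M, 0 <= M & forall x, S x -> `|f x| <= M.
Proof.
have cS : compact S by exact: compact_ts_itv.
have /compact_bounded[M [_ HM]] := continuous_compact cf cS.
exists (`|M| + 1); first by rewrite addr_ge0.
move=> x Sx; apply: (HM (`|M| + 1)); last by exists x.
by rewrite (le_lt_trans (ler_norm M))// ltrDl.
Qed.

(** The extension of [f] to the real line that holds its value across each gap of [S]. *)
Let h := f \o floor_ts.

(** A monotone map followed by a function continuous on the closed set [S] is measurable, and [h] is
    bounded because [S] is compact. *)
Let integrable_h : (@lebesgue_measure R).-integrable `[a, b] (EFin \o h).
Proof.
apply: measurable_bounded_integrable => //.
- by rewrite /= lebesgue_measure_itv/= lte_fin ab ltry.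
- apply: (@measurable_comp _ _ _ _ _ _ S).
  + by apply: closed_measurable; exact: closed_ts_itv.
  + by move=> _ [x _ <-].
  + apply: subspace_continuous_measurable_fun => //.
    by apply: closed_measurable; exact: closed_ts_itv.
  + exact: nondecreasing_measurable.
- have [M M0 HM] := bounded_f.
  exists M; split; first exact: num_real.
  by move=> x Mx y _; exact: le_trans (HM _ (floor_ts_mem y)) (ltW Mx).
Qed.

Lemma delta_antiderivative_exists : exists F, delta_antiderivative T a b f F.
Proof.
have [M M0 HM] := bounded_f.
pose F t := \int[@lebesgue_measure R]_(x in `[a, t]) h x.
exists F.
have key s t l e : S s -> S t -> s <= t ->
    (forall x, s < x -> x < t -> `|h x - l| <= e) ->
    `|F t - F s - l * (t - s)| <= e * (t - s).
  move=> [_ /andP[as_ _]] [_ /andP[_ tb]] st H.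
  exact: Rintegral_itv_approx integrable_h _ _ _ _.
have hM x : `|h x| <= M by exact: HM.
split.
  apply/within_continuous_normP => t St e e0.
  have M1 : 0 < M + 1 by lra.
  (* [F] is Lipschitz with constant [M]; the [+ 1] covers [M = 0]. *)
  exists (e / (M + 1)); first exact: divr_gt0.
  have lip u v : S u -> S v -> u <= v -> `|F v - F u| <= M * (v - u).
    move=> Su Sv uv.
    have := key u v 0 M Su Sv uv; rewrite mul0r subr0; apply.
    by move=> x _ _; rewrite subr0.
  move=> s Ss; rewrite ltr_pdivlMr// => st.
  have [ts|/ltW ts] := leP t s.
    apply: le_lt_trans (lip _ _ St Ss ts) _.
    apply: le_lt_trans st; rewrite ger0_norm ?subr_ge0//; nra.
  rewrite distrC; apply: le_lt_trans (lip _ _ Ss St ts) _.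
  apply: le_lt_trans st; rewrite distrC ger0_norm ?subr_ge0//; nra.
move=> t St tb st e e0; apply/near_within_normP.
have ge := forward_jump_ge Tb tb.
have le := forward_jump_le Tb tb.
have mem := forward_jump_mem cT Tb tb.
rewrite -/st in ge le mem.
have Sst : S st.
  split => //; rewrite le// andbT (le_trans _ ge)//.
  by case: St => _ /andP[].
move: (ge); rewrite le_eqVlt => /predU1P[tst|tst].
- have [d d0 H] := (within_continuous_normP _ _).1 cf _ St _ e0.
  exists d => // s Ss sd; rewrite -tst.
  (* For [x] between [u] and [v], its floor also lies between them, hence within [d] of [t], where
     [f] varies by less than [e]. *)
  have hft u v : S u -> S v -> `|u - t| < d -> `|v - t| < d ->
      forall x, u < x -> x < v -> `|h x - f t| <= e.
    move=> Su Sv ud vd x ux xv; apply/ltW/H; first exact: floor_ts_mem.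
    have ax : a <= x by case: Su => _ /andP[au _]; lra.
    have := floor_ts_ge Su (ltW ux); have := floor_ts_le ax.
    by move: ud vd; rewrite !ltr_norml; lra.
  have td : `|t - t| < d by rewrite subrr normr0.
  have [ts|/ltW ts] := leP t s.
    rewrite -normrN [X in `|X|](_ : _ = F s - F t - f t * (s - t)); last by ring.
    rewrite [`|t - s|]distrC [`|s - t|]ger0_norm ?subr_ge0//.
    exact: (key _ _ _ _ _ _ _ (hft _ _ St Ss td sd)).
  rewrite [`|t - s|]ger0_norm ?subr_ge0//.
  exact: (key _ _ _ _ _ _ _ (hft _ _ Ss St sd td)).
- have M1 : 0 < M + M + 1 by lra.
  have st0 : 0 < st - t by rewrite subr_gt0.
  (* The first bound forces [s <= t], as no point of [T] lies in ]t, st[. The second makes the error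
     on [s, t], at most (M + M) (t - s), smaller than e (st - t). *)
  exists (Num.min (st - t) (e * (st - t) / (M + M + 1))).
    by rewrite lt_min st0 divr_gt0// mulr_gt0.
  move=> s Ss; rewrite lt_min => /andP[sst].
  rewrite ltr_pdivlMr// => sM.
  have {}sst : s <= t.
    rewrite leNgt; apply/negP => ts.
    have := le _ Ss.1 ts; move: sst; rewrite ltr_norml; lra.
  (* On the gap ]t, st[ the function [h] is constantly [f t], so [key] applies with error 0. *)
  have jump : F st - F t = f t * (st - t).
    apply/eqP; rewrite -subr_eq0 -normr_le0.
    rewrite (le_trans (key t st (f t) 0 _ _ _ _)) ?mul0r// => x tx xst.
    suff -> : h x = f t by rewrite subrr normr0.
    congr f; apply: le_anti; rewrite (floor_ts_ge St (ltW tx)) andbT.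
    rewrite leNgt; apply/negP => tfl.
    have := le _ (floor_ts_mem x).1 tfl.
    have ax : a <= x by case: St => _ /andP[au _]; lra.
    have := floor_ts_le ax; lra.
  rewrite [X in `|X|](_ : _ = F t - F s - f t * (t - s)); last first.
    have -> : F st = F t + f t * (st - t) by rewrite -jump; ring.
    ring.
  have := key s t (f t) (M + M) Ss St sst.
  have dist x : `|h x - f t| <= M + M.
    by rewrite (le_trans (ler_normB _ _))// lerD// HM.
  move=> /(_ (fun x _ _ => dist x)) k; apply: le_trans k _.
  have -> : `|st - s| = (st - t) + (t - s) by rewrite ger0_norm; lra.
  move: sM; rewrite distrC ger0_norm ?subr_ge0// => sM.
  have : 0 <= e * (t - s) by rewrite mulr_ge0 ?subr_ge0// ltW.
  lra.
Qed.

End delta_antiderivative_exists.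

(** * Linearity and monotonicity of the delta integral *)

Section delta_integral_theory.
Variables (R : realType) (T : set R) (a b : R).
Hypotheses (cT : closed T) (Ta : T a) (Tb : T b) (ab : a < b).

Lemma delta_integralZD (k : R) (f g : R -> R) :
  {within ts_itv T a b, continuous f} -> {within ts_itv T a b, continuous g} ->
  delta_integral T a b (fun t => k * f t + g t) =
  k * delta_integral T a b f + delta_integral T a b g.
Proof.
move=> /(delta_antiderivative_exists cT Ta Tb ab)[F dF].
move=> /(delta_antiderivative_exists cT Ta Tb ab)[G dG].
rewrite (delta_integralE _ _ _ _ dF)// (delta_integralE _ _ _ _ dG)//.
by rewrite (delta_integralE _ _ _ _ (delta_antiderivativeZD k dF dG))//; ring.
Qed.

Lemma le_delta_integral (f g : R -> R) :
  {within ts_itv T a b, continuous f} -> {within ts_itv T a b, continuous g} ->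
  (forall t, ts_itv T a b t -> f t <= g t) ->
  delta_integral T a b f <= delta_integral T a b g.
Proof.
move=> /(delta_antiderivative_exists cT Ta Tb ab)[F dF].
move=> /(delta_antiderivative_exists cT Ta Tb ab)[G dG] fg.
rewrite (delta_integralE _ _ _ _ dF)// (delta_integralE _ _ _ _ dG)//.
exact: delta_antiderivative_le fg.
Qed.

End delta_integral_theory.

(** * Reflection of the time scale, exchanging nabla and delta *)

Definition opp_set (R : realType) (T : set R) : set R := [set t | T (- t)].

Section reflection.
Variable R : realType.
Implicit Types (T : set R) (a b t l : R) (f F G : R -> R).

Let image_opp_set T : -%R @` opp_set T = T.
Proof.
apply/seteqP; split=> [_ [t Tt <-]//|t Tt].
by exists (- t); rewrite ?opprK// /opp_set/= opprK.
Qed.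

Let opp_setK T : opp_set (opp_set T) = T.
Proof. by apply/seteqP; split=> t; rewrite /opp_set/= opprK. Qed.

(** Negation turns suprema into infima, and this covers the default values too: [inf T] is the
    opposite of the supremum of the reflected set. *)
Lemma backward_jumpE T t :
  backward_jump T t = - forward_jump (opp_set T) (- t).
Proof.
rewrite /backward_jump /forward_jump.
set A := [set s | T s /\ s < t]; set B := [set s | _].
have BA : B = opp_set A.
  by apply/seteqP; split=> s; rewrite /B /A /opp_set/= ltrNl.
have -> : `[< B = set0 >] = `[< A = set0 >].
  rewrite BA; apply/asbool_equiv_eq; split=> A0; last first.
    by apply/seteqP; split=> // x; rewrite /opp_set/= A0.
  by rewrite -[A]opp_setK A0; apply/seteqP; split.
case: asboolP => _; last by rewrite BA /inf image_opp_set opprK.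
by rewrite /inf -{1}[T]opp_setK image_opp_set.
Qed.

Lemma ts_itv_opp T a b : ts_itv (opp_set T) (- b) (- a) = opp_set (ts_itv T a b).
Proof.
by apply/seteqP; split=> t [Tt /andP[? ?]]; split=> //; apply/andP; split; lra.
Qed.

Lemma within_continuous_opp (A : set R) f : {within A, continuous f} ->
  {within opp_set A, continuous (fun t => f (- t))}.
Proof.
move=> /within_continuous_normP cf; apply/within_continuous_normP => t At e e0.
have [d d0 H] := cf _ At _ e0; exists d => // s As st; apply: H => //.
by rewrite -opprD normrN.
Qed.

(** Changing sign in both argument and value keeps the derivative [l] unchanged, and the increment
    of the reflected function from [- b] to [- a] is again [G b - G a]. *)
Lemma nabla_derivativeP T a b G t l :
  is_nabla_derivative T a b G t l <->
  is_delta_derivative (opp_set T) (- b) (- a) (fun s => - G (- s)) (- t) l.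
Proof.
rewrite /is_nabla_derivative /is_delta_derivative ts_itv_opp backward_jumpE.
set st := forward_jump _ _.
have E s : - G (- st) - - G (- s) - l * (st - s) =
    - (G (- st) - G (- s) - l * (- st - - s)) by ring.
have D s : `|st - s| = `|- st - - s| by rewrite -opprD normrN.
split=> H e e0; have /near_within_normP[d d0 K] := H e e0;
    apply/near_within_normP; exists d => // s Ss sd.
  by rewrite E normrN D; apply: K => //; rewrite -normrN opprD opprK.
have := K (- s); rewrite E normrN D !opprK; apply.
  by rewrite /opp_set/= opprK.
by rewrite -normrN opprD !opprK.
Qed.

Lemma nabla_antiderivativeP T a b f G :
  nabla_antiderivative T a b f G <->
  delta_antiderivative (opp_set T) (- b) (- a)
    (fun t => f (- t)) (fun t => - G (- t)).
Proof.
rewrite /nabla_antiderivative /delta_antiderivative ts_itv_opp.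
split=> -[cG dG]; split.
- by move=> x; apply: cvgN; exact: within_continuous_opp.
- move=> t St ta; have := dG _ St; rewrite ltrNr => /(_ ta).
  by move=> /nabla_derivativeP; rewrite opprK.
- have := within_continuous_opp cG; rewrite opp_setK => {}cG.
  rewrite (_ : G = fun t => - - G (- - t)).
    by move=> x; apply: cvgN; exact: cG.
  by apply/funext => t; rewrite !opprK.
- move=> t St ta; have := dG (- t); rewrite ltrN2 opprK => /(_ _ ta) H.
  by apply/nabla_derivativeP; apply: H; rewrite /opp_set/= opprK.
Qed.

(** Both sides apply [xget] to the same set of candidate values, with the same default. *)
Lemma nabla_integralE T a b f :
  nabla_integral T a b f =
  delta_integral (opp_set T) (- b) (- a) (fun t => f (- t)).
Proof.
rewrite /nabla_integral /delta_integral; congr xget.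
apply/seteqP; split=> _ [G dG <-].
  by exists (fun t => - G (- t)); [exact/nabla_antiderivativeP|rewrite !opprK addrC].
exists (fun t => - G (- t)); last by rewrite opprK addrC.
apply/nabla_antiderivativeP; rewrite [X in delta_antiderivative _ _ _ _ X](_ : _ = G)//.
by apply/funext => t; rewrite !opprK.
Qed.

Lemma closed_opp_set T : closed T -> closed (opp_set T).
Proof. by move=> cT; apply: (preimage_closed _ cT) => x _; exact: opp_continuous. Qed.

End reflection.

(** * The diamond integral as a positive linear functional *)

Section diamond_integral_theory.
Variables (R : realType) (T : set R) (alpha a b : R).
Hypotheses (cT : closed T) (Ta : T a) (Tb : T b) (ab : a < b).
Hypothesis alpha01 : 0 <= alpha <= 1.

Lemma diamond_integralZD (k : R) (f g : R -> R) :
  {within ts_itv T a b, continuous f} -> {within ts_itv T a b, continuous g} ->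
  diamond_integral T alpha a b (fun t => k * f t + g t) =
  k * diamond_integral T alpha a b f + diamond_integral T alpha a b g.
Proof.
move=> cf cg; rewrite /diamond_integral delta_integralZD// !nabla_integralE.
rewrite delta_integralZD ?opprK ?ltrN2 ?ts_itv_opp//=; last 5 first.
- exact: closed_opp_set.
- by rewrite /opp_set/= opprK.
- by rewrite /opp_set/= opprK.
- exact: within_continuous_opp.
- exact: within_continuous_opp.
ring.
Qed.

(** The weights [alpha] and [1 - alpha] are nonnegative, so monotonicity passes from the delta
    integrals over [T] and its reflection. *)
Lemma le_diamond_integral (f g : R -> R) :
  {within ts_itv T a b, continuous f} -> {within ts_itv T a b, continuous g} ->
  (forall t, ts_itv T a b t -> f t <= g t) ->
  diamond_integral T alpha a b f <= diamond_integral T alpha a b g.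
Proof.
move=> cf cg fg; have /andP[a0 a1] := alpha01.
rewrite /diamond_integral !nabla_integralE; apply: lerD.
  by rewrite ler_wpM2l// le_delta_integral.
rewrite ler_wpM2l ?subr_ge0// le_delta_integral ?ltrN2 ?ts_itv_opp//=.
- exact: closed_opp_set.
- by rewrite /opp_set/= opprK.
- by rewrite /opp_set/= opprK.
- exact: within_continuous_opp.
- exact: within_continuous_opp.
- by move=> t; exact: fg.
Qed.

(** Additivity on 0 + 0 gives I 0 = I 0 + I 0. *)
Lemma diamond_integral0 : diamond_integral T alpha a b (fun=> 0) = 0.
Proof.
have c0 : {within ts_itv T a b, continuous (fun=> 0 : R)} by move=> x; exact: cvg_cst.
have := diamond_integralZD 1 c0 c0.
under [in LHS]eq_fun do rewrite mulr0 addr0.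
lra.
Qed.

Lemma diamond_integral_ge0 (f : R -> R) :
  {within ts_itv T a b, continuous f} -> (forall t, ts_itv T a b t -> 0 <= f t) ->
  0 <= diamond_integral T alpha a b f.
Proof.
move=> cf f0; rewrite -diamond_integral0; apply: le_diamond_integral => //.
by move=> x; exact: cvg_cst.
Qed.

End diamond_integral_theory.

(** * Real powers, and the passage from Young to Hoelder *)

(** Away from 0 the power is differentiable; at 0, |y| < e^(1/r) gives |y|^r < e. *)
Lemma continuous_norm_powR (R : realType) (r : R) : 0 < r ->
  continuous (fun x : R => `|x| `^ r).
Proof.
move=> r0 x; have [->|x0] := eqVneq x 0; last first.
  apply: (@continuous_comp R R R (fun x : R => `|x|) (@powR R ^~ r)).
    exact: norm_continuous.
  apply: differentiable_continuous; apply/derivable1_diffP.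
  by apply: derivable_powR; rewrite in_itv/= andbT normr_gt0.
rewrite /continuous_at normr0 powR0 ?gt_eqF//.
apply/cvgrPdist_lt => e e0; apply/nbhs_ballP.
exists (e `^ r^-1); first by rewrite /= powR_gt0.
move=> y; rewrite /ball/= !sub0r !normrN => ye.
rewrite ger0_norm ?powR_ge0// -[e]powRr1 ?ltW// -(@mulVf _ r) ?gt_eqF//.
by rewrite powRrM gt0_ltr_powR// nnegrE ?powR_ge0.
Qed.

(** [A], [B], [X] stand for the integrals of |f|^p, |g|^q, |f g|. The free weights [c], [d] can be
    tuned until the right-hand side is at most 1/p + 1/q = 1. *)
Lemma le_powR_conjugate (R : realType) (A B X p q : R) :
  0 <= A -> 0 <= B -> 0 < p -> 0 < q -> p^-1 + q^-1 = 1 ->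
  (forall c d, 0 < c -> 0 < d ->
    c * d * X <= c `^ p / p * A + d `^ q / q * B) ->
  X <= A `^ p^-1 * B `^ q^-1.
Proof.
move=> A0 B0 p0 q0 pq young.
(* The absolute values put the bound in terms of |x|^r, which is continuous on the whole line, ready
   for the limit in [e]. *)
have approx (e : R) : 0 < e -> X <= `|A + e| `^ p^-1 * `|B + e| `^ q^-1.
  move=> e0.
  have Ae : 0 < A + e by lra.
  have Be : 0 < B + e by lra.
  rewrite (gtr0_norm Ae) (gtr0_norm Be).
  have pw Y r : 0 < Y -> 0 < r -> ((Y `^ r^-1)^-1) `^ r = Y^-1.
    move=> Y0 r0; rewrite -powRN -powRrM mulNr mulVf ?gt_eqF//.
    by rewrite powR_inv1// ltW.
  set u := (A + e) `^ _; set v := (B + e) `^ _.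
  have u0 : 0 < u by exact: powR_gt0.
  have v0 : 0 < v by exact: powR_gt0.
  have u'0 : 0 < u^-1 by rewrite invr_gt0.
  have v'0 : 0 < v^-1 by rewrite invr_gt0.
  have := young _ _ u'0 v'0.
  rewrite /u /v !pw// -/u -/v => H.
  have : u^-1 * v^-1 * X <= 1.
    apply: le_trans H _; rewrite -pq.
    (* This is Y / (Y + e) <= 1, valid for [Y = 0] as well thanks to the shift. *)
    have frac Y r : 0 <= Y -> 0 < r -> (Y + e)^-1 / r * Y <= r^-1.
      move=> Y0 r0; rewrite mulrAC ler_piMl ?invr_ge0 ?(ltW r0)//.
      by rewrite mulrC ler_pdivrMr; lra.
    by apply: lerD; exact: frac.
  by rewrite -invfM mulrC ler_pdivrMr ?mulr_gt0// mul1r.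
have p'0 : 0 < p^-1 by rewrite invr_gt0.
have q'0 : 0 < q^-1 by rewrite invr_gt0.
rewrite -[in X in _ <= X](ger0_norm A0) -[in X in _ <= X](ger0_norm B0).
have cvg_shift (Y r : R) : 0 < r -> `|Y + e| `^ r @[e --> 0^'+] --> `|Y| `^ r.
  move=> r0; apply: cvg_at_right_filter; rewrite -[in X in _ --> X](addr0 Y).
  apply: (@continuous_comp _ _ _ (fun e => Y + e) (fun x => `|x| `^ r)).
    by apply: cvgD; [exact: cvg_cst|exact: cvg_id].
  exact: continuous_norm_powR.
apply: (cvgr_to_ge (cvgM (cvg_shift A _ p'0) (cvg_shift B _ q'0))).
by near=> e; apply: approx; near: e; exact: nbhs_right_gt.
Unshelve. all: by end_near. Qed.

(** * Hoelder's inequality for the diamond integral *)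

Theorem mainTheorem1 (R : realType) (T : set R) (a b alpha : R)
    (f g : R -> R) (p q : R)
    (hT : time_scale T) (ha : T a) (hb : T b) (hab : a < b)
    (halpha : 0 <= alpha <= 1)
    (hf : {within ts_itv T a b, continuous f})
    (hg : {within ts_itv T a b, continuous g})
    (hp : 1 < p) (hq : q = p / (p - 1)) :
  diamond_integral T alpha a b (fun t => `|f t * g t|) <=
    (diamond_integral T alpha a b (fun t => `|f t| `^ p)) `^ (1 / p) *
    (diamond_integral T alpha a b (fun t => `|g t| `^ q)) `^ (1 / q).
Proof.
have cT := hT.2.
have p0 : 0 < p by lra.
have q0 : 0 < q by rewrite hq divr_gt0//; lra.
have pq : p^-1 + q^-1 = 1 by rewrite hq; field; apply/andP; split; lra.
have cpow r (h : R -> R) : 0 < r -> {within ts_itv T a b, continuous h} ->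
    {within ts_itv T a b, continuous (fun t => `|h t| `^ r)}.
  move=> r0 ch; apply: (@within_continuous_comp _ _ _ _ h (fun x => `|x| `^ r)) => //.
  by move=> x _; exact: continuous_norm_powR.
have cfp := cpow _ _ p0 hf; have cgq := cpow _ _ q0 hg.
have cfg : {within ts_itv T a b, continuous (fun t => `|f t * g t|)}.
  apply: (@within_continuous_comp _ _ _ _ (fun t => f t * g t) (fun x : R => `|x|)).
    by move=> x _; exact: norm_continuous.
  by move=> x; apply: cvgM; [exact: hf|exact: hg].
rewrite !div1r; apply: le_powR_conjugate => //.
- by apply: diamond_integral_ge0 => // t _; exact: powR_ge0.
- by apply: diamond_integral_ge0 => // t _; exact: powR_ge0.
move=> c d c0 d0.
have c0' : {within ts_itv T a b, continuous (fun=> 0 : R)}.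
  by move=> x; exact: cvg_cst.
(* The trailing [+ 0] presents a multiple as the combination [k * h + 0], so that linearity yields
   homogeneity. *)
have cZ (k : R) (h : R -> R) : {within ts_itv T a b, continuous h} ->
    {within ts_itv T a b, continuous (fun t => k * h t + 0)}.
  by move=> ch; exact: within_continuous_lincomb.
have IZ (k : R) (h : R -> R) : {within ts_itv T a b, continuous h} ->
    diamond_integral T alpha a b (fun t => k * h t + 0) =
    k * diamond_integral T alpha a b h.
  by move=> ch; rewrite diamond_integralZD// diamond_integral0// addr0.
have cgqZ := cZ (d `^ q / q) _ cgq.
(* With all constants moved inside, the claim compares two diamond integrals and reduces to a
   pointwise inequality. *)
rewrite -(IZ (c * d) _ cfg) -(IZ (d `^ q / q) _ cgq) -diamond_integralZD//.
apply: le_diamond_integral => //.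
- exact: cZ.
- exact: within_continuous_lincomb.
- move=> t _; rewrite !addr0.
  (* Young's inequality for c |f t| and d |g t|; [powRM] then separates the weights. *)
  have := @conjugate_powR R (c * `|f t|) (d * `|g t|) p q.
  rewrite !powRM ?(ltW c0, ltW d0)// normrM.
  move=> /(_ _ _ p0 q0 pq) H; have : 0 <= c * `|f t| by rewrite mulr_ge0// ltW.
  have : 0 <= d * `|g t| by rewrite mulr_ge0// ltW.
  by move=> dg /H/(_ dg) h; lra.
Qed.
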